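(* There exists a TTS($331$) whose $2$-block intersection graph is bipartite, connected and non-Hamiltonian.
   Context: A twofold triple system of order $v$, TTS($v$), is a pair $(V,\mathcal{B})$ where $V$ is a set of $v$ points and $\mathcal{B}$ is a collection (repeated blocks allowed) of $3$-element subsets of $V$, called blocks, such that each $2$-element subset of $V$ is contained in precisely two blocks of $\mathcal{B}$. The $2$-block intersection graph ($2$-BIG) of $(V,\mathcal{B})$ is the graph whose vertices are the blocks of $\mathcal{B}$, where two blocks $B_1,B_2$ are adjacent if and only if $|B_1\cap B_2|=2$. A graph is Hamiltonian if it contains a Hamilton cycle. *)

(* Defs.v *)
From mathcomp Require Import all_boot.

Set Implicit Arguments.
Unset Strict Implicit.
Unset Printing Implicit Defensive.

(* The collection of blocks is a family indexed by a finite type [I], so that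
   repeated blocks are allowed and count as distinct blocks. *)
Definition is_TTS (v : nat) (V I : finType) (blk : I -> {set V}) : Prop :=
  [/\ #|V| = v,
      forall i : I, #|blk i| = 3
    & forall P : {set V}, #|P| = 2 -> #|[set i : I | P \subset blk i]| = 2].

(* For blocks of size 3 this relation is symmetric and irreflexive; two copies
   of a repeated block meet in 3 points, hence are not adjacent. *)
Definition two_BIG (V I : finType) (blk : I -> {set V}) : rel I :=
  fun i j => #|blk i :&: blk j| == 2.

Definition bipartite (T : finType) (e : rel T) : Prop :=
  exists A : {set T}, forall x y : T, e x y -> (x \in A) != (y \in A).

Definition connected_graph (T : finType) (e : rel T) : Prop :=
  0 < #|T| /\ forall x y : T, connect e x y.

(* A cycle of a simple graph has at least 3 vertices, whereas [ucycle e s] also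
   holds for s = [:: x; y] with x and y adjacent. *)
Definition hamiltonian (T : finType) (e : rel T) : Prop :=
  exists s : seq T, [/\ 2 < size s, ucycle e s & forall x : T, x \in s].

(* Main.v *)
Require Import Defs.
From mathcomp Require Import all_boot.
From mathcomp Require Import all_algebra.

Set Implicit Arguments.
Unset Strict Implicit.
Unset Printing Implicit Defensive.

Import GRing.Theory.

(** Why the theorem holds.  The points are the residues modulo 331, and the
    blocks are the translates of 110 base blocks.  These fall into two classes
    of 55, and within each class every nonzero residue occurs exactly once as a
    difference of two elements of a base block.  Each class therefore generates
    a Steiner triple system (lemmas [block_exists] and [block_unique]): every
    pair of points lies in one block of each class, so that the two classes
    together form a twofold triple system whose 2-block intersection graph is
    bipartite and cubic, with the pairs of points as its edges.

    A Hamilton cycle crosses, at each block, exactly two of its three pairs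
    (lemma [turning_point]), and it crosses the boundary of every proper
    nonempty set of blocks (lemma [crossed_boundary]).  The obstruction is a
    gadget: 34 triples on 16 points, in which 49 pairs lie in two triples and
    four pairs lie in a single one, so that it is attached to the rest of the
    graph by just four edges.  Whatever a Hamilton cycle does outside, it must
    cross one particular edge among these four, the pair {0,1} of the gadget:
    if that pair is left out, then every choice of two pairs per triple closes
    a cycle inside the gadget (lemma [gadget_trapped], a finite search, made
    applicable by [all_trapped_sound]).

    Multiplication by 31, which has order 3 modulo 331, maps the design to
    itself.  The gadget is placed so that its pair {0,1} becomes {7, 217}, where
    217 = 31 * 7; in the two other copies of the gadget, obtained by multiplying
    by 31 and by its square, this pair becomes {217, 107} and {107, 7}.  All
    three are pairs of the block {7, 217, 107}, so a Hamilton cycle would cross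
    all the pairs of this block, while [turning_point] allows only two. *)

(** * Hamilton cycles seen on the pairs of points *)

Section HamiltonCycle.

Variables (V I : finType) (blk : I -> {set V}) (v : nat).
Hypothesis ttsB : is_TTS v blk.
Variable s : seq I.
Hypothesis s_gt2 : 2 < size s.
Hypothesis s_cycle : ucycle (two_BIG blk) s.
Hypothesis s_all : forall i, i \in s.

(** An edge of the 2-block intersection graph joins the two blocks that contain
    some pair of points, so the edges of the cycle are recorded as pairs. *)
Definition crossed (P : {set V}) : bool :=
  [exists i, P \subset blk i :&: blk (next s i)].

Let card_blk i : #|blk i| = 3. Proof. by case: ttsB. Qed.

Let s_uniq : uniq s. Proof. by case/andP: s_cycle. Qed.

Let card_next i : #|blk i :&: blk (next s i)| = 2.
Proof. by case/andP: s_cycle => /next_cycle/(_ (s_all i))/eqP. Qed.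

Lemma pair_in_two_blocks (P : {set V}) (i j k : I) : #|P| = 2 -> i != j ->
  P \subset blk i -> P \subset blk j -> P \subset blk k -> (k == i) || (k == j).
Proof.
case: ttsB => _ _ /[apply] two ij Pi Pj Pk.
have sub : [set i; j] \subset [set i | P \subset blk i].
  by apply/subsetP=> x; rewrite !inE => /orP[]/eqP->.
have /eqP eqij : [set i; j] == [set i | P \subset blk i].
  by rewrite eqEcard sub two cards2 ij.
by have := Pk; rewrite -(in_set (fun k => P \subset blk k)) -eqij !inE.
Qed.

Let next_neq i : next s i != i.
Proof.
apply/eqP => e; have := card_next i.
by rewrite e setIid card_blk.
Qed.

Let next2_neq i : next s (next s i) != i.
Proof.
have := s_all i; case/rot_to => k t def_s.
rewrite -!(next_rot k s_uniq) def_s.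
have := s_uniq; rewrite -(rot_uniq k) def_s.
have := s_gt2; rewrite -(size_rot k) def_s.
case: t {def_s} => [|a [|b t]] //= _.
rewrite eqxx !inE !negb_or => /and3P[/and3P[ia ib it] /andP[ab _] _].
by rewrite (ifN_eqC _ _ ia) eqxx eq_sym.
Qed.

(** The Hamilton cycle enters and leaves a block through two different pairs,
    which in a 3-set share one point [z]; the third pair is not crossed, because
    the only blocks containing it are this one and a block that is not its
    neighbour on the cycle. *)
Lemma turning_point (i : I) : exists2 z, z \in blk i &
  forall P : {set V}, #|P| = 2 -> P \subset blk i -> crossed P = (z \in P).
Proof.
pose k := prev s i.
have ki : next s k = i by exact: next_prev.
pose Pj := blk i :&: blk (next s i); pose Pk := blk i :&: blk k.
have cj : #|Pj| = 2 by exact: card_next.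
have ck : #|Pk| = 2 by rewrite -(card_next k) ki setIC.
have Pjk : Pj != Pk.
  apply/eqP => e.
  have nk : next s i != i by [].
  have: (k == i) || (k == next s i).
    apply: (@pair_in_two_blocks Pj) => //; rewrite ?subsetIl ?subsetIr 1?eq_sym //.
    by rewrite e subsetIr.
  rewrite -{1}ki eq_sym (negPf (next_neq k)) /= => /eqP kn.
  by have := next2_neq i; rewrite -kn ki eqxx.
have PUsub : Pj :|: Pk \subset blk i by rewrite subUset !subsetIl.
have PU : Pj :|: Pk = blk i.
  apply/eqP; rewrite eqEcard PUsub card_blk ltnNge; apply/negP => le2.
  have e1 : Pj = Pj :|: Pk by apply/eqP; rewrite eqEcard subsetUl cj.
  have e2 : Pk = Pj :|: Pk by apply/eqP; rewrite eqEcard subsetUr ck.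
  by case/eqP: Pjk; rewrite e1 {2}e2.
have /eqP/cards1P[z PI] : #|Pj :&: Pk| = 1.
  by have := cardsUI Pj Pk; rewrite PU card_blk cj ck => -[].
have /setIP[zj zk] : z \in Pj :&: Pk by rewrite PI set11.
exists z => [|P cP Pi]; first by rewrite -PU inE zj.
have crP : crossed P = (P == Pj) || (P == Pk).
  apply/existsP/orP => [[i' /subsetIP[Pi' Pn]]|[]/eqP->].
  - have: (i == i') || (i == next s i').
      by apply: (@pair_in_two_blocks P) => //; rewrite eq_sym.
    case/orP => /eqP e.
      by left; rewrite eqEcard cP cj subsetI {1}e Pi' e Pn.
    right; rewrite eqEcard cP ck subsetI Pi /k e.
    by rewrite prev_next // Pi'.
  - by exists i.
  - by exists k; rewrite ki setIC.
rewrite crP; apply/idP/idP => [/orP[]/eqP->//|zP].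
have /cards2P[a [b [ab defP]]] : #|P| == 2 by rewrite cP.
have [c [cz cP' Pzc]] : exists c, [/\ c != z, c \in P & P = [set z; c]].
  move: zP; rewrite defP !inE => /orP[]/eqP->.
    by exists b; rewrite eq_sym ab !inE eqxx orbT.
  by exists a; rewrite ab !inE eqxx setUC.
have : c \in Pj :|: Pk by rewrite PU (subsetP Pi).
rewrite inE => /orP[cc|cc]; apply/orP; [left|right];
  rewrite eqEcard ?cj ?ck cP leqnn andbT Pzc; apply/subsetP=> x;
  by rewrite in_set2 => /orP[]/eqP->.
Qed.

(** Otherwise [W] would be closed under [next s], hence contain the whole cycle. *)
Lemma crossed_boundary (W : {set I}) : W != set0 -> W != setT ->
  exists i j (P : {set V}), [/\ i \in W, j \notin W, #|P| = 2,
    P \subset blk i :&: blk j & crossed P].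
Proof.
move=> /set0Pn[i0 i0W] WT.
have [/existsP[i /andP[iW niW]]|] := boolP [exists i, (i \in W) && (next s i \notin W)].
  exists i, (next s i), (blk i :&: blk (next s i)); split=> //.
  by apply/existsP; exists i.
rewrite negb_exists => /forallP closedW; case/eqP: WT; apply/setP => j.
rewrite inE; have : fconnect (next s) i0 j.
  by rewrite (fconnect_cycle (cycle_next s_uniq)).
move/iter_findex=> <-; elim: (findex _ _ _) => //= n IHn.
by have := closedW (iter n (next s) i0); rewrite IHn negbK.
Qed.

End HamiltonCycle.

(** * The base blocks *)

Definition mul31 (x : nat) : nat := (31 * x) %% 331.

(** The residues that carry the 16 points of the gadget in its first copy. *)
Definition position : seq nat :=
  [:: 7; 217; 84; 10; 112; 309; 114; 39;
      150; 56; 171; 157; 212; 78; 325; 146].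

(** The Boolean is the class of the triple.  Each triple but the first shares a
    pair with an earlier one; this order also lets the search in
    [gadget_trapped] close cycles early. *)
Definition gadget : seq (bool * seq nat) :=
  [:: (false, [:: 0; 1; 2]); (true, [:: 1; 2; 3]); (false, [:: 2; 3; 4]);
      (false, [:: 1; 3; 5]); (true, [:: 3; 5; 6]); (true, [:: 0; 2; 6]);
      (false, [:: 2; 5; 6]); (true, [:: 2; 4; 5]); (true, [:: 1; 5; 7]);
      (false, [:: 4; 5; 7]); (true, [:: 3; 4; 8]); (false, [:: 3; 6; 8]);
      (false, [:: 4; 8; 9]); (true, [:: 4; 7; 9]); (true, [:: 1; 8; 9]);
      (false, [:: 1; 7; 8]); (true, [:: 6; 7; 8]); (false, [:: 6; 7; 9]);
      (false, [:: 0; 6; 10]); (true, [:: 6; 10; 11]); (false, [:: 6; 11; 12]);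
      (true, [:: 6; 9; 12]); (false, [:: 10; 11; 13]); (true, [:: 9; 10; 13]);
      (false, [:: 9; 10; 12]); (true, [:: 0; 10; 12]); (false, [:: 0; 12; 14]);
      (true, [:: 11; 12; 14]); (false, [:: 9; 13; 14]); (true, [:: 0; 13; 14]);
      (true, [:: 9; 14; 15]); (false, [:: 11; 14; 15]); (true, [:: 11; 13; 15]);
      (false, [:: 0; 13; 15])].

Definition position_in (k : nat) : seq nat := iter k (map mul31) position.

Definition copy (ps : seq nat) : seq (bool * seq nat) :=
  [seq (B.1, [seq nth 0 ps p | p <- B.2]) | B <- gadget].

Definition mul31_orbit (B : bool * seq nat) : seq (bool * seq nat) :=
  [:: B; (B.1, map mul31 B.2); (B.1, map mul31 (map mul31 B.2))].

(** The block {7, 217, 107} comes first, so that copy [k] of the gadget occupies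
    the positions from [1 + 34 * k] to [34 + 34 * k].  The seven last blocks
    supply the differences that the copies leave out. *)
Definition base : seq (bool * seq nat) :=
  (true, [:: 7; 217; 107]) ::
  copy (position_in 0) ++ copy (position_in 1) ++ copy (position_in 2) ++
  mul31_orbit (true, [:: 7; 146; 162]) ++ mul31_orbit (false, [:: 217; 56; 222]) ++
  [:: (false, [:: 245; 56; 146])].

Definition side (i : nat) : bool := (nth (false, [::]) base i).1.
Definition residues (i : nat) : seq nat := (nth (false, [::]) base i).2.

Definition arcs (s : seq nat) : seq (nat * nat) :=
  [seq a <- [seq (x, y) | x <- s, y <- s] | a.1 != a.2].

(** The residue of [a.2 - a.1]; 331 is added first because subtraction on [nat]
    is truncated. *)
Definition diff (a : nat * nat) : nat := (a.2 + (331 - a.1)) %% 331.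

(** The ways for two points to lie in a base block of class [b]. *)
Definition slots (b : bool) : seq (nat * (nat * nat)) :=
  [seq (i, a) | i <- [seq i <- iota 0 110 | side i == b], a <- arcs (residues i)].

Definition shift1 (s : seq nat) : seq nat := [seq x.+1 %% 331 | x <- s].

Lemma base_wf :
  all (fun i => [&& size (residues i) == 3, uniq (residues i)
                  & all (fun x => x < 331) (residues i)])
    (iota 0 110).
Proof. by vm_compute. Qed.

Lemma slots_uniq b : uniq [seq diff sl.2 | sl <- slots b].
Proof. by case: b; vm_compute. Qed.

Lemma slots_size b : size [seq diff sl.2 | sl <- slots b] == 330.
Proof. by case: b; vm_compute. Qed.

Lemma slots_range b : all (fun d => 0 < d < 331) [seq diff sl.2 | sl <- slots b].
Proof. by case: b; vm_compute. Qed.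

(** Makes the untranslated base blocks a connected part of the graph. *)
Lemma base_connected :
  all (fun i =>
    has (fun j => size [seq x <- residues i | x \in residues j] == 2) (iota 0 i))
    (iota 1 109).
Proof. by vm_compute. Qed.

(** Links the base blocks with their translates by 1, and so all translates with
    each other. *)
Lemma base_shift :
  size [seq x <- residues 104 | x \in shift1 (residues 106)] == 2.
Proof. by vm_compute. Qed.

(** * The gadget forces an edge *)

Definition pairs (T : seq nat) : seq (nat * nat) :=
  [seq e <- [seq (x, y) | x <- T, y <- T] | e.1 < e.2].

Definition gadget_pairs : seq (seq (nat * nat)) := [seq pairs B.2 | B <- gadget].

Definition containing (T : eqType) (e : T) (Ts : seq (seq T)) : seq (seq T) :=
  [seq t <- Ts | e \in t].

Section Trap.

(** A cubic graph with some dangling edges: each vertex is the sequence of its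
    three edges, and an edge is dangling when it lies in a single vertex. *)
Variables (E : eqType) (H : seq (seq E)).

(** The path that leaves the vertex [t] by the edge [e] and follows the unique
    continuation while there is one; [N] lists the edges known to be unused.
    A path that comes back to [t] goes round until the bound [n] is reached. *)
Fixpoint walk (n : nat) (t : seq E) (e : E) (N : seq E) : seq (seq E) :=
  t :: if n is n'.+1 then
         if [seq e' <- t | (e' != e) && (e' \notin N)] is [:: e'] then
           if [seq t' <- containing e' H | t' != t] is [:: t'] then walk n' t' e' N
           else [::]
         else [::]
       else [::].

(** All the edges that leave [W] are unused. *)
Definition trap (W : seq (seq E)) (N : seq E) : bool :=
  all (all (fun e => (e \in N) || (1 < size (containing e W)))) W.

(** Search over the vertices [ts], choosing for each the edge [e] that is not
    used; [N] and [Y] collect the unused and the used edges.  A branch ends when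
    the choice contradicts [N] or [Y], or when the path through the current
    vertex is trapped; the search fails if a branch survives all vertices.
    The three outcomes are chained by conditionals because [vm_compute] evaluates
    both arguments of a Boolean connective. *)
Fixpoint all_trapped (n : nat) (ts : seq (seq E)) (N Y : seq E) : bool :=
  if ts is t :: ts' then
    all (fun e => let o := rem e t in
      if (e \in Y) || has (mem N) o then true
      else if trap (undup (walk n t (head e o) (e :: N))) (e :: N) then true
      else all_trapped n ts' (e :: N) (o ++ Y)) t
  else false.

(** From here on [f] tells which edges a Hamilton cycle uses.  [f_leaves] is what
    is left of its connectedness: some edge of [f] lies in just one vertex of
    [W], hence leads out of [W]. *)
Variable f : E -> bool.
Hypothesis H_uniq : forall t, t \in H -> uniq t.
Hypothesis f_turn : forall t, t \in H ->
  exists2 e, e \in t & forall e', e' \in t -> f e' = (e' != e).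
Hypothesis f_leaves : forall W, uniq W -> {subset W <= H} -> W != [::] ->
  exists t e, [/\ t \in W, e \in t, f e & size (containing e W) <= 1].

Lemma walk_sub n t e N : t \in H -> {subset walk n t e N <= H}.
Proof.
elim: n t e => [|n IHn] t e tH /= u; rewrite in_cons => /predU1P[->//|] //.
case: [seq e' <- t | _] => [|e' []] //.
case def: [seq t' <- _ | _] => [|t' []] // /IHn; apply.
have : t' \in [seq t' <- containing e' H | t' != t] by rewrite def inE.
by rewrite !mem_filter => /and3P[].
Qed.

(** The unused edges of [f] select a branch of the search, and on that branch
    neither of the two reasons to stop can arise: the edges of [N] and [Y] agree
    with [f], and a trap would contradict [f_leaves]. *)
Lemma all_trapped_sound n ts N Y : {subset ts <= H} ->
  (forall e, e \in N -> ~~ f e) -> (forall e, e \in Y -> f e) ->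
  ~~ all_trapped n ts N Y.
Proof.
elim: ts N Y => [|t ts IHts] N Y //= tsH fN fY.
have tH : t \in H by apply: tsH; rewrite mem_head.
have [e et fe] := f_turn tH.
apply/allPn; exists e => //=.
have fN' e' : e' \in e :: N -> ~~ f e'.
  by rewrite inE => /predU1P[->|/fN//]; rewrite fe // eqxx.
have fo e' : e' \in rem e t -> f e'.
  by rewrite (rem_filter _ (H_uniq tH)) mem_filter => /andP[ne e't]; rewrite fe.
case: ifP => [/orP[/fY|/hasP[e' /fo fe' /fN]]|_].
- by rewrite fe // eqxx.
- by rewrite fe'.
case: ifP => [/allP trapW|_]; last first.
  apply: IHts => // [u uts|e']; first by apply: tsH; rewrite inE uts orbT.
  by rewrite mem_cat => /orP[/fo|/fY].
case: (@f_leaves (undup (walk n t (head e (rem e t)) (e :: N)))).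
- exact: undup_uniq.
- by move=> u; rewrite mem_undup => /(walk_sub tH).
- apply/eqP=> /(congr1 (fun s => t \in s)); rewrite mem_undup in_nil.
  by case: (n) => [|m] /=; rewrite mem_head.
move=> u [e' [uW e'u fe' small]].
have /allP/(_ _ e'u)/orP[/fN'|] := trapW _ uW; first by rewrite fe'.
by rewrite ltnNge small.
Qed.

End Trap.

(** * The two Steiner triple systems *)

(* Keeps conversion from evaluating the table of base blocks. *)
Opaque residues side.

Notation Z331 := 'Z_331.
Notation block_id := ('I_110 * 'Z_331)%type.

(** The block [(i, t)] is the translate by [t] of the [i]-th base block. *)
Definition block (i : block_id) : {set Z331} :=
  [set x : Z331 | nat_of_ord (x - i.2)%R \in residues i.1].

Lemma val_residue (n : nat) : n < 331 -> nat_of_ord (n%:R%R : Z331) = n.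
Proof. by move=> lt_n; rewrite val_Zp_nat // modn_small. Qed.

Lemma diffE (x y t : Z331) :
  diff (nat_of_ord (x - t)%R, nat_of_ord (y - t)%R) = nat_of_ord (y - x)%R.
Proof.
have valB (a b : Z331) : diff (nat_of_ord a, nat_of_ord b) = nat_of_ord (b - a)%R.
  by rewrite /diff /= modnDmr.
by rewrite valB opprB addrA subrK.
Qed.

Lemma card_translate (t : Z331) (s : seq nat) : uniq s -> all (fun n => n < 331) s ->
  #|[set x : Z331 | nat_of_ord (x - t)%R \in s]| = size s.
Proof.
move=> s_uniq /allP lt_s.
rewrite -(size_map (fun n => t + n%:R)%R s) -(card_uniqP _).
  apply: eq_card => x; rewrite inE; apply/idP/mapP => [xs|[n ns ->]].
    by exists (nat_of_ord (x - t)%R) => //; rewrite natr_Zp addrC subrK.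
  by rewrite addrAC subrr add0r val_residue ?lt_s.
rewrite map_inj_in_uniq // => m n ms ns /addrI /(congr1 (@nat_of_ord _)).
by rewrite !val_residue ?lt_s.
Qed.

Lemma residues_wf (i : 'I_110) :
  [/\ size (residues i) = 3, uniq (residues i) & all (fun n => n < 331) (residues i)].
Proof.
have /and3P[/eqP] := allP base_wf i (etrans (mem_iota 0 110 i) (ltn_ord i)).
by [].
Qed.

Lemma mem_slots b (i : 'I_110) (x y : nat) :
  ((i : nat, (x, y)) \in slots b) =
  [&& side i == b, x \in residues i, y \in residues i & x != y].
Proof.
rewrite /slots; apply/allpairsPdep/and4P => [[j [a [jb aj [ej ea]]]]|[ib xi yi xy]].
  move: jb aj; rewrite -ej -ea !mem_filter => /andP[-> _] /andP[xy].
  by case/allpairsP=> -[u v] [? ? [? ?]]; subst x y.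
exists (i : nat), (x, y); rewrite !mem_filter ib xy mem_iota /=.
by split=> //; rewrite allpairs_f.
Qed.

Lemma slot_of_points (i : block_id) (x y : Z331) : x != y ->
  x \in block i -> y \in block i ->
  (i.1 : nat, (nat_of_ord (x - i.2)%R, nat_of_ord (y - i.2)%R)) \in slots (side i.1).
Proof.
move=> xy; rewrite [x \in _]inE [y \in _]inE => xi yi.
rewrite mem_slots xi yi eqxx !andTb; apply: contra xy => /eqP/ord_inj.
by move/addIr->.
Qed.

Lemma inj_of_uniq_map (T1 T2 : eqType) (f : T1 -> T2) (s : seq T1) :
  uniq (map f s) -> {in s &, injective f}.
Proof.
elim: s => //= a s IHs /andP[fa /IHs inj_f] x y.
rewrite !in_cons => /predU1P[->|xs] /predU1P[->|ys] // e; last exact: inj_f.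
  by rewrite e map_f in fa.
by rewrite -e map_f in fa.
Qed.

(** The difference [y - x] determines the base block and the places of [x] and
    [y] in it, since the differences of a class are distinct. *)
Lemma block_unique (i j : block_id) (x y : Z331) : side i.1 = side j.1 -> x != y ->
  x \in block i -> y \in block i -> x \in block j -> y \in block j -> i = j.
Proof.
move=> ij xy xi yi xj yj.
have si := slot_of_points xy xi yi; have := slot_of_points xy xj yj.
rewrite -ij => sj.
have e := inj_of_uniq_map (slots_uniq _) si sj
  (etrans (diffE _ _ _) (esym (diffE _ _ _))).
have e1 : nat_of_ord i.1 = nat_of_ord j.1 := congr1 fst e.
have e2 : nat_of_ord (x - i.2)%R = nat_of_ord (x - j.2)%R := congr1 (fun sl => sl.2.1) e.
rewrite [i]surjective_pairing [j]surjective_pairing.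
by congr (_, _); [exact: ord_inj | move/ord_inj/addrI/oppr_inj: e2].
Qed.

(** 330 distinct differences between 1 and 330. *)
Lemma slots_all b : [seq diff sl.2 | sl <- slots b] =i iota 1 330.
Proof.
have sub : {subset [seq diff sl.2 | sl <- slots b] <= iota 1 330}.
  by move=> e /(allP (slots_range b)) e_range; rewrite mem_iota.
have le_size : size (iota 1 330) <= size [seq diff sl.2 | sl <- slots b].
  by rewrite size_iota (eqP (slots_size b)).
exact: (uniq_min_size (slots_uniq b) sub le_size).2.
Qed.

Lemma slots_lt b i a : (i, a) \in slots b -> i < 110.
Proof.
rewrite /slots => /allpairsPdep[j [c [jb _ [-> _]]]].
by move: jb; rewrite mem_filter mem_iota => /andP[].
Qed.

Lemma diff_onto b (d : nat) : 0 < d < 331 ->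
  exists (i : 'I_110) (m n : nat),
    [/\ side i = b, m \in residues i, n \in residues i & d = diff (m, n)].
Proof.
move=> d_range.
have : d \in [seq diff sl.2 | sl <- slots b] by rewrite slots_all mem_iota.
case/mapP=> -[i0 [m n]] mn_slot d_eq.
have lt_i0 := slots_lt mn_slot.
move: mn_slot; rewrite (mem_slots _ (Ordinal lt_i0)) => /and4P[/eqP sb mi ni _].
by exists (Ordinal lt_i0), m, n.
Qed.

Lemma block_exists b (x y : Z331) : x != y ->
  exists i : block_id, [/\ side i.1 = b, x \in block i & y \in block i].
Proof.
move=> xy.
have yx_range : 0 < nat_of_ord (y - x)%R < 331.
  rewrite lt0n (ltn_ord (y - x)%R) andbT; apply: contra xy => /eqP d0.
  by rewrite eq_sym -subr_eq0; apply/eqP/ord_inj.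
have [i [m [n [sb mi ni yx]]]] := diff_onto b yx_range.
have [_ _ /allP lt_pts] := residues_wf i.
pose t := (x - m%:R)%R.
have xm : nat_of_ord (x - t)%R = m.
  by rewrite /t opprB addrC subrK val_residue ?lt_pts.
have yn : nat_of_ord (y - t)%R = n.
  have := diffE x y t; rewrite xm yx => /eqP.
  by rewrite eqn_modDr modn_small ?(ltn_ord (y - t)%R) // modn_small ?lt_pts // => /eqP.
by exists (i, t); rewrite !inE xm yn.
Qed.

Lemma side_neq_of_meet (i j : block_id) (x y : Z331) : i != j -> x != y ->
  x \in block i -> y \in block i -> x \in block j -> y \in block j ->
  side i.1 != side j.1.
Proof.
move=> ij xy xi yi xj yj; apply: contra ij => /eqP e; apply/eqP.
exact: (block_unique e xy).
Qed.

Lemma block_TTS : is_TTS 331 block.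
Proof.
split; first by rewrite card_ord.
  move=> i; have [sz u lt] := residues_wf i.1; apply: etrans sz; exact: card_translate.
move=> P /eqP/cards2P[x [y [xy ->]]].
have [i [iA xi yi]] := block_exists true xy.
have [j [jB xj yj]] := block_exists false xy.
rewrite (_ : [set k | _] = [set i; j]).
  by rewrite cards2; case: eqP => // ij; move: iA; rewrite ij jB.
apply/setP => k; rewrite [LHS]inE in_set2 subUset !sub1set; apply/andP/orP.
  move=> [xk yk]; case: (boolP (side k.1)) => sk; [left|right]; apply/eqP.
    by apply: (block_unique _ xy); rewrite // iA.
  by apply: (block_unique _ xy); rewrite // jB; apply: negbTE.
by case=> /eqP->.
Qed.

Lemma block_bipartite : bipartite (two_BIG block).
Proof.
exists [set i : block_id | side i.1] => i j ij; rewrite !inE.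
have /cards2P[x [y [xy def]]] := ij.
have /setIP[xi xj] : x \in block i :&: block j by rewrite def set21.
have /setIP[yi yj] : y \in block i :&: block j by rewrite def set22.
apply: (side_neq_of_meet _ xy) => //; apply/eqP => e; move: ij.
by rewrite e /two_BIG setIid; have [_ -> _] := block_TTS.
Qed.

(** * Connectedness *)

Lemma card_meet (i j : 'I_110) (t u : Z331) (s : seq nat) :
  (forall x, (x \in block (j, u)) = (nat_of_ord (x - t)%R \in s)) ->
  #|block (i, t) :&: block (j, u)| = size [seq x <- residues i | x \in s].
Proof.
move=> ju; have [_ pi_uniq /allP lt_pi] := residues_wf i.
rewrite -(card_translate t); last first.
- by apply/allP => x; rewrite mem_filter => /andP[_ /lt_pi].
- exact: filter_uniq.
by apply: eq_card => x; rewrite in_setI ju !inE mem_filter andbC.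
Qed.

Lemma mem_block_shift (i : 'I_110) (t x : Z331) :
  (x \in block (i, t + 1)%R) = (nat_of_ord (x - t)%R \in shift1 (residues i)).
Proof.
have succ (u : Z331) : nat_of_ord (u + 1)%R = (nat_of_ord u).+1 %% 331.
  by rewrite -(val_Zp_nat (isT : 1 < 331)) -natr1 natr_Zp.
have [_ _ /allP lt_pts] := residues_wf i.
rewrite inE opprD addrA; apply/idP/mapP => [xi|[n ni e]].
  by exists (nat_of_ord (x - t - 1)%R) => //; rewrite -succ subrK.
suff -> : nat_of_ord (x - t - 1)%R = n by [].
have -> : (x - t = n%:R + 1)%R.
  by apply: ord_inj; rewrite e succ val_residue ?lt_pts.
by rewrite addrK val_residue ?lt_pts.
Qed.

Lemma block_connected : connected_graph (two_BIG block).
Proof.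
split; first by apply/card_gt0P; exists (ord0, 0%R).
have csym : connect_sym (two_BIG block).
  by apply: sym_connect_sym => i j; rewrite /two_BIG setIC.
have inside (t : Z331) (i : 'I_110) : connect (two_BIG block) (ord0, t) (i, t).
  case: i => i; elim/ltn_ind: i => -[_ lt0|i IHi lt_i].
    by rewrite (_ : Ordinal lt0 = ord0) ?connect0 //; apply: ord_inj.
  have : i.+1 \in iota 1 109 by rewrite mem_iota.
  case/(allP base_connected)/hasP => j.
  rewrite mem_iota => /= lt_j /eqP meet.
  have lt_j' : j < 110 by apply: ltn_trans lt_i.
  apply: connect_trans (IHi j lt_j lt_j') _; rewrite csym; apply: connect1.
  rewrite /two_BIG (@card_meet (Ordinal lt_i) (Ordinal lt_j') t t (residues j)) ?meet //.
  by move=> x; rewrite inE.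
have step (t : Z331) : connect (two_BIG block) (ord0, t) (ord0, t + 1)%R.
  pose i := Ordinal (isT : 104 < 110); pose j := Ordinal (isT : 106 < 110).
  apply: connect_trans (inside t i) _; rewrite csym.
  apply: connect_trans (inside _ j) _; rewrite csym; apply: connect1.
  by rewrite /two_BIG (card_meet i (fun x => mem_block_shift j t x)) base_shift.
have all_t (t : Z331) : connect (two_BIG block) (ord0, 0%R) (ord0, t).
  rewrite -[t]natr_Zp; elim: (nat_of_ord t) => [|n IHn]; first exact: connect0.
  by apply: connect_trans IHn _; rewrite -natr1.
move=> [i t] [j u]; apply: connect_trans (_ : connect _ _ (ord0, 0%R)) _.
  by rewrite csym; apply: connect_trans (all_t t) (inside t i).
exact: connect_trans (all_t u) (inside u j).
Qed.

(** * The copies of the gadget in the design *)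

Lemma position_in_wf : all (fun k =>
  [&& size (position_in k) == 16, uniq (position_in k)
    & all (fun n => n < 331) (position_in k)]) (iota 0 3).
Proof. by vm_compute. Qed.

Lemma residues_copy : all (fun k => all (fun j =>
  residues (1 + (34 * k + j)) ==
    [seq nth 0 (position_in k) p | p <- nth [::] (unzip2 gadget) j])
  (iota 0 34)) (iota 0 3).
Proof. by vm_compute. Qed.

(** The last condition says that the pairs of a triple that contain a given point
    of it are all its pairs but one. *)
Lemma gadget_wf : all (fun T => [&& all (fun p => p < 16) T, uniq (pairs T) &
  all (fun p => has (fun e => all (fun e' =>
    ((p == e'.1) || (p == e'.2)) == (e' != e)) (pairs T)) (pairs T)) T]) (unzip2 gadget).
Proof. by vm_compute. Qed.

(** No two-pairs-per-triple choice that omits the pair {0,1} escapes a trap.  A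
    path inside the gadget visits at most 34 triples. *)
Lemma gadget_trapped : all_trapped gadget_pairs 34 gadget_pairs [:: (0, 1)] [::].
Proof. by vm_compute. Qed.

Section GadgetCopy.

Variable s : seq block_id.
Hypothesis s_gt2 : 2 < size s.
Hypothesis s_cycle : ucycle (two_BIG block) s.
Hypothesis s_all : forall i, i \in s.

(** The copy of the gadget under consideration. *)
Variable k : nat.
Hypothesis lt_k : k < 3.

Let point_of (p : nat) : Z331 := (nth 0 (position_in k) p)%:R%R.

Let used (e : nat * nat) : bool := crossed block s [set point_of e.1; point_of e.2].

Let gadget_block (t : seq (nat * nat)) : block_id :=
  (inord (1 + (34 * k + index t gadget_pairs)), 0%R).

Let val_gadget_block t : t \in gadget_pairs ->
  nat_of_ord (gadget_block t).1 = 1 + (34 * k + index t gadget_pairs).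
Proof.
rewrite -index_mem => lt_t; rewrite inordK // (@leq_ltn_trans (1 + (34 * 2 + 33))) //.
by rewrite leq_add2l leq_add // leq_mul2l.
Qed.

Let residues_gadget_block t : t \in gadget_pairs -> exists2 T, T \in unzip2 gadget &
  pairs T = t /\ residues (gadget_block t).1 = [seq nth 0 (position_in k) p | p <- T].
Proof.
move=> tG; have lt_t : index t gadget_pairs < 34 by rewrite -index_mem in tG.
exists (nth [::] (unzip2 gadget) (index t gadget_pairs)); first exact: mem_nth.
split.
  rewrite -[RHS](nth_index [::] tG) /gadget_pairs.
  by rewrite (nth_map (false, [::])) // (nth_map (false, [::])).
rewrite val_gadget_block //.
have k_in : k \in iota 0 3 by rewrite mem_iota.
have t_in : index t gadget_pairs \in iota 0 34 by rewrite mem_iota.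
exact: eqP (allP (allP residues_copy k k_in) _ t_in).
Qed.

Let point_of_inj : {in [pred p | p < 16] &, injective point_of}.
Proof.
have k_in : k \in iota 0 3 by rewrite mem_iota.
have /and3P[/eqP size_k uniq_k /allP lt_k331] := allP position_in_wf k k_in.
have lt_size p : p < 16 -> p < size (position_in k) by rewrite size_k.
move=> p q /lt_size lt_p /lt_size lt_q /(congr1 (@nat_of_ord _)).
by rewrite !val_residue ?lt_k331 ?mem_nth // => /eqP; rewrite nth_uniq // => /eqP.
Qed.

Let mem_gadget_block t T (x : Z331) :
  t \in gadget_pairs -> T \in unzip2 gadget -> pairs T = t ->
  residues (gadget_block t).1 = [seq nth 0 (position_in k) p | p <- T] ->
  reflect (exists2 p, p \in T & x = point_of p) (x \in block (gadget_block t)).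
Proof.
move=> tG TG _ pts_t.
have k_in : k \in iota 0 3 by rewrite mem_iota.
have /and3P[/eqP size_k _ /allP lt_k331] := allP position_in_wf k k_in.
have /and3P[/allP lt16 _ _] := allP gadget_wf T TG.
have lt_r p : p \in T -> nth 0 (position_in k) p < 331.
  by move/lt16=> lt_p; rewrite lt_k331 // mem_nth // size_k.
rewrite inE pts_t subr0; apply: (iffP mapP) => -[p pT e]; exists p => //.
  by rewrite /point_of -e natr_Zp.
by rewrite e val_residue ?lt_r.
Qed.

Let mem_pairs T e : T \in unzip2 gadget -> e \in pairs T ->
  [/\ e.1 \in T, e.2 \in T, e.1 < 16, e.2 < 16 & e.1 < e.2].
Proof.
move=> TG; have /and3P[/allP lt16 _ _] := allP gadget_wf T TG.
rewrite mem_filter => /andP[lt12 /allpairsP[[p q] [pT qT e_pq]]].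
by rewrite e_pq /= in lt12 *; rewrite !lt16.
Qed.

Let pair_sub_block t e : t \in gadget_pairs -> e \in t ->
  [set point_of e.1; point_of e.2] \subset block (gadget_block t).
Proof.
move=> tG; have [T TG [pT pts_t]] := residues_gadget_block tG.
rewrite -{1}pT => /(mem_pairs TG)[e1T e2T _ _ _].
rewrite subUset !sub1set; apply/andP; split.
  by apply/(mem_gadget_block _ tG TG pT pts_t); exists e.1.
by apply/(mem_gadget_block _ tG TG pT pts_t); exists e.2.
Qed.

Let used_turn t : t \in gadget_pairs ->
  exists2 e, e \in t & forall e', e' \in t -> used e' = (e' != e).
Proof.
move=> tG; have [T TG [pT pts_t]] := residues_gadget_block tG.
have /and3P[/allP lt16 _ /allP turnT] := allP gadget_wf T TG.
have [z /(mem_gadget_block _ tG TG pT pts_t)[p pTm ->] turn] :=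
  turning_point block_TTS s_gt2 s_cycle s_all (gadget_block t).
have /hasP[e et /allP e_turn] := turnT p pTm.
exists e => [|e' e't]; first by rewrite -pT.
have := e't; rewrite -{1}pT => /(mem_pairs TG)[e1T e2T lt1 lt2 lt12].
rewrite pT in e_turn; rewrite -(eqP (e_turn e' e't)) /used turn; last exact: pair_sub_block.
  by rewrite in_set2 !(inj_in_eq point_of_inj) ?inE ?lt16.
by rewrite cards2 (inj_in_eq point_of_inj) // ltn_eqF.
Qed.

Let gadget_block_inj t t' : t \in gadget_pairs -> t' \in gadget_pairs ->
  gadget_block t = gadget_block t' -> t = t'.
Proof.
move=> tG t'G /(congr1 (fun i : block_id => nat_of_ord i.1)).
rewrite !val_gadget_block // => /eqP; rewrite !eqn_add2l => /eqP e.
by rewrite -(nth_index [::] tG) e nth_index.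
Qed.

(** The boundary edge given by [crossed_boundary] lies in a gadget triple of [W]
    and in a block [j] outside; a second triple of [W] containing it would make
    three blocks on one pair. *)
Let used_leaves W : uniq W -> {subset W <= gadget_pairs} -> W != [::] ->
  exists t e, [/\ t \in W, e \in t, used e & size (containing e W) <= 1].
Proof.
move=> W_uniq WG W0; pose WI := [set i in map gadget_block W].
have WI0 : WI != set0.
  case: (W) (W0) @WI => // t W' _ WI; apply/set0Pn; exists (gadget_block t).
  by rewrite inE map_f // mem_head.
have WIT : WI != setT.
  apply/eqP => /setP/(_ (ord0, 0%R)); rewrite !inE.
  case/mapP=> t tW /(congr1 (fun i : block_id => nat_of_ord i.1)).
  by rewrite val_gadget_block ?WG.
have [_ [j [P [/[!inE]/mapP[t tW ->] jW /eqP/cards2P[x [y [xy ->]]] Pij Px]]]] :=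
  crossed_boundary s_cycle s_all WI0 WIT.
have [T TG [pT pts_t]] := residues_gadget_block (WG _ tW).
move: (Pij); rewrite subsetI subUset !sub1set => /andP[/andP[xt yt] Pj].
have [e et def_e] : exists2 e, e \in t & [set x; y] = [set point_of e.1; point_of e.2].
  have [p pTm xp] := mem_gadget_block x (WG _ tW) TG pT pts_t xt.
  have [q qTm yq] := mem_gadget_block y (WG _ tW) TG pT pts_t yt.
  rewrite -pT; case: (ltngtP p q) => pq; last by rewrite xp yq pq eqxx in xy.
    by exists (p, q); rewrite ?mem_filter ?pq ?allpairs_f // xp yq.
  by exists (q, p); rewrite ?mem_filter ?pq ?allpairs_f // xp yq setUC.
exists t, e; split=> //; first by rewrite /used -def_e.
rewrite leqNgt; apply/negP => two_on.
have [t' [t'W et' t't]] : exists t', [/\ t' \in W, e \in t' & t' != t].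
  have on_uniq : uniq (containing e W) by exact: filter_uniq.
  have on_sub u : u \in containing e W -> u \in W /\ e \in u.
    by rewrite mem_filter => /andP[].
  case: (containing e W) two_on on_uniq on_sub => [|a [|b l]] //= _.
  rewrite in_cons negb_or => /andP[/andP[ab _] _] on_sub.
  have [aW ea] := on_sub a (mem_head _ _).
  have [bW eb] : b \in W /\ e \in b by apply: on_sub; rewrite !in_cons eqxx orbT.
  have [at_|at_] := eqVneq a t; last by exists a.
  by exists b; split=> //; rewrite eq_sym -at_.
have: (j == gadget_block t) || (j == gadget_block t').
  apply: (pair_in_two_blocks block_TTS (P := [set x; y])) => //.
  - by rewrite cards2 xy.
  - by apply: contra t't => /eqP/gadget_block_inj->; rewrite ?WG.
  - by rewrite def_e pair_sub_block ?WG.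
  - by rewrite def_e pair_sub_block ?WG.
by case/orP => /eqP ej; rewrite ej map_f in jW.
Qed.

Lemma spoke_crossed : used (0, 1).
Proof.
apply: contraT => f01.
have /negP[] : ~~ all_trapped gadget_pairs 34 gadget_pairs [:: (0, 1)] [::].
  apply: (all_trapped_sound _ used_turn used_leaves) => // [t tG|e].
    have [T TG [<- _]] := residues_gadget_block tG.
    by have /and3P[] := allP gadget_wf T TG.
  by rewrite inE => /eqP->.
exact: gadget_trapped.
Qed.

End GadgetCopy.

(** * The theorem *)

Theorem mainTheorem3 :
  exists (V I : finType) (blk : I -> {set V}),
    [/\ is_TTS 331 blk,
        bipartite (two_BIG blk),
        connected_graph (two_BIG blk)
      & ~ hamiltonian (two_BIG blk)].
Proof.
exists 'Z_331, ('I_110 * 'Z_331)%type, block; split.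
- exact: block_TTS.
- exact: block_bipartite.
- exact: block_connected.
(* The cycle crosses the three pairs of the first base block, whose turning point
   [z] would have to lie in all of them. *)
case=> s [s_gt2 s_cycle s_all].
have [z _ turn] := turning_point block_TTS s_gt2 s_cycle s_all (ord0, 0%R).
pose hub := [:: 7; 217; 107].
have lt_hub n : n \in hub -> n < 331 by rewrite !inE => /or3P[]/eqP->.
have hub_eq m n : m \in hub -> n \in hub -> ((m%:R : Z331)%R == n%:R%R) = (m == n).
  by move=> /lt_hub lt_m /lt_hub lt_n; rewrite -(inj_eq (@ord_inj _)) !val_residue.
have hub_blk n : n \in hub -> (n%:R%R : Z331) \in block (ord0, 0%R).
  by move=> n_hub; rewrite inE subr0 val_residue // lt_hub.
have z_in m n : m \in hub -> n \in hub -> m != n ->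
    crossed block s [set m%:R%R; n%:R%R] -> z \in [set (m%:R : Z331); n%:R]%R.
  move=> m_hub n_hub mn; rewrite turn //; first by rewrite cards2 hub_eq // mn.
  by rewrite subUset !sub1set !hub_blk.
have spoke := spoke_crossed s_gt2 s_cycle s_all.
have z0 : z \in [set (7%:R : Z331); 217%:R]%R := z_in 7 217 isT isT isT (spoke 0 isT).
have z1 : z \in [set (217%:R : Z331); 107%:R]%R := z_in 217 107 isT isT isT (spoke 1 isT).
have z2 : z \in [set (107%:R : Z331); 7%:R]%R := z_in 107 7 isT isT isT (spoke 2 isT).
case/set2P: z0 z1 z2 => ->; first by rewrite in_set2 !hub_eq.
by rewrite !in_set2 !hub_eq.
Qed.
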